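(* Let $\delta > 0$. Let $d$ be an integer with $d > 16/\delta$, and set $\delta_0 = 2\sqrt{\delta}$. Let $\mathcal{C}_0 \in \mathbb{R}^{k\times d}$ be a matrix with the following properties: - $k \le 100\,\delta_0\log(1/\delta_0)\, d$; - each column of $\mathcal{C}_0$ contains at most $100\log(1/\delta_0)$ ones; - $\mathcal{C}_0$ satisfies the robust null space property of order $\delta_0 d$ with constants $\rho_0 < 1/3$ and $\tau_0 > 0$. Let $G$ be an $(N,d,\lambda)$-expander with $\lambda < 3\sqrt{d}$. Then the Tanner measurement matrix $A \in \mathbb{R}^{2kN \times dN}$ of $G$ and $\mathcal{C}_0$ satisfies the robust null space property of order $\delta N d$ with constants $\rho = \frac{2\rho_0}{1-\rho_0}$ and $\tau = \frac{\tau_0}{1-\rho_0}$.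
   Context: Robust null space property: a matrix $A \in \mathbb{R}^{m\times n}$ satisfies the robust null space property of order $s$ with constants $0<\rho<1$ and $\tau>0$ if for every $S \subseteq [n]$ with $|S| \le s$ and every $\bm{x} \in \mathbb{R}^n$, $$\|\bm{x}_S\|_1 \le \rho\,\|\bm{x}_{\bar S}\|_1 + \tau\,\|A\bm{x}\|_1.$$ Here $\bm{x}_I$ is the restriction of $\bm{x}$ to the coordinates in $I$, and $\bar S = [n]\setminus S$. Spectral expander: an $(N,d,\lambda)$-expander is a simple undirected $d$-regular graph on $N$ vertices whose adjacency matrix has second largest eigenvalue in absolute value at most $\lambda$. Double cover: the double cover of a graph $G=(V,E)$ is the bipartite graph $H=(L\cup R, E_H)$ with $L=R=V$, where for every edge $(u,v)\in E$ both $(u,v)$ and $(v,u)$ belong to $E_H$. Thus $H$ has $dN$ edges. Tanner measurement matrix: let $H$ be the double cover of $G$, and label the $dN$ edges of $H$ arbitrarily and distinctly by $1,\dots,dN$. For $\mathcal{C}_0 \in \mathbb{R}^{k\times d}$, the Tanner measurement matrix of $G$ and $\mathcal{C}_0$ is the $2kN \times dN$ matrix $A$ defined by $A\bm{x} = (\mathcal{C}_0\,\bm{x}_{\Gamma(v)})_{v\in L\cup R}$ for all $\bm{x}\in\mathbb{R}^{dN}$. Here $\Gamma(v)$ is the tuple of the $d$ edges incident to $v$, listed in increasing order of label. That is, $A\bm{x}$ is the concatenation of the vectors $\mathcal{C}_0\bm{x}_{\Gamma(v)}$ over all vertices $v$ of $H$. *)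

(* Defs.v *)
From mathcomp Require Import all_boot all_order all_algebra.
From mathcomp Require Import reals.

Set Implicit Arguments.
Unset Strict Implicit.
Unset Printing Implicit Defensive.

Import Order.TTheory GRing.Theory Num.Theory.
Local Open Scope ring_scope.

Definition norm1_on (R : realType) (n : nat) (S : {set 'I_n}) (x : 'cV[R]_n) : R :=
  \sum_(i in S) `|x i 0|.

Definition norm1 (R : realType) (n : nat) (x : 'cV[R]_n) : R := norm1_on setT x.

(* The order s is a real number, as orders such as delta * d need not be
   integers. *)
Definition robust_nsp (R : realType) (m n : nat) (A : 'M[R]_(m, n))
    (s rho tau : R) : Prop :=
  [/\ 0 < rho, rho < 1, 0 < tau &
      forall (S : {set 'I_n}) (x : 'cV[R]_n), #|S|%:R <= s ->
        norm1_on S x <= rho * norm1_on (~: S) x + tau * norm1 (A *m x)].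

Definition adjacency (R : realType) (N : nat) (g : rel 'I_N) : 'M[R]_N :=
  \matrix_(u, v) (g u v)%:R.

(* s lists the eigenvalues of M with multiplicity, in decreasing order of
   absolute value. *)
Definition abs_spectrum (R : realType) (n : nat) (M : 'M[R]_n) (s : seq R) : Prop :=
  char_poly M = \prod_(z <- s) ('X - z%:P) /\
  sorted (fun a b : R => `|b| <= `|a|) s.

(* Real symmetric matrices have such an s, and `|s`_1| does not depend on how
   ties in absolute value are broken. *)
Definition second_abs_eigenvalue_le (R : realType) (n : nat) (M : 'M[R]_n)
    (lambda : R) : Prop :=
  exists s : seq R, abs_spectrum M s /\ `|s`_1| <= lambda.

Definition expander (R : realType) (N d : nat) (lambda : R) (g : rel 'I_N) : Prop :=
  [/\ symmetric g, irreflexive g,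
      forall u : 'I_N, #|[set v | g u v]| = d &
      second_abs_eigenvalue_le (adjacency R g) lambda].

(* (u, v) is the edge joining the copy of u in L to the copy of v in R. *)
Definition dcover_edges (N : nat) (g : rel 'I_N) : {set 'I_N * 'I_N} :=
  [set p | g p.1 p.2].

(* The vertices of the double cover are 'I_(N + N), with lshift N u the copy of
   u in L and rshift N v the copy of v in R. *)
Definition dcover_incident (N : nat) (v : 'I_(N + N)) (p : 'I_N * 'I_N) : bool :=
  match split v with
  | inl u => p.1 == u
  | inr w => p.2 == w
  end.

(* A labelling is given by its inverse: ell e is the edge with label e.  Labels
   start at 0. *)
Definition edge_labelling (N d : nat) (g : rel 'I_N)
    (ell : 'I_(d * N) -> 'I_N * 'I_N) : Prop :=
  injective ell /\ [set ell e | e in 'I_(d * N)] = dcover_edges g.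

(* Labels of the edges at v; enum lists 'I_(d * N) in increasing order. *)
Definition Gamma (N d : nat) (ell : 'I_(d * N) -> 'I_N * 'I_N) (v : 'I_(N + N)) :
    seq 'I_(d * N) :=
  [seq e <- enum 'I_(d * N) | dcover_incident v (ell e)].

(* The default value 0 of nth is never used when size (Gamma ell v) = d, see
   size_Gamma. *)
Definition local_view (R : realType) (N d : nat)
    (ell : 'I_(d * N) -> 'I_N * 'I_N) (x : 'cV[R]_(d * N)) (v : 'I_(N + N)) :
    'cV[R]_d :=
  \col_j [seq x e 0 | e <- Gamma ell v]`_j.

(* mxvec concatenates the rows of its argument, so this is the vector of length
   (N + N) * k = 2kN formed by the blocks C0 *m local_view ell x v. *)
Definition tanner_map (R : realType) (N d k : nat)
    (ell : 'I_(d * N) -> 'I_N * 'I_N) (C0 : 'M[R]_(k, d)) (x : 'cV[R]_(d * N)) :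
    'cV[R]_((N + N) * k) :=
  (mxvec (\matrix_(v < N + N) (C0 *m local_view ell x v)^T))^T.

(* The matrix of tanner_map, see tanner_matrixE. *)
Definition tanner_matrix (R : realType) (N d k : nat)
    (ell : 'I_(d * N) -> 'I_N * 'I_N) (C0 : 'M[R]_(k, d)) :
    'M[R]_((N + N) * k, d * N) :=
  \matrix_(r, e) tanner_map ell C0 (delta_mx e 0) r 0.

Lemma size_Gamma (N d : nat) (g : rel 'I_N) (ell : 'I_(d * N) -> 'I_N * 'I_N)
    (v : 'I_(N + N)) :
  symmetric g -> (forall u : 'I_N, #|[set w | g u w]| = d) ->
  edge_labelling g ell -> size (Gamma ell v) = d.
Proof.
move=> gC greg [ell_inj ellE].
have -> : size (Gamma ell v) = #|[set p in dcover_edges g | dcover_incident v p]|.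
  have -> : [set p in dcover_edges g | dcover_incident v p]
            = ell @: [set e | dcover_incident v (ell e)].
    apply/setP => p; rewrite inE -ellE; apply/andP/imsetP.
      by case=> /imsetP [e _ ->] he; exists e; rewrite ?inE.
    by case=> e; rewrite inE => he ->; split=> //; apply/imsetP; exists e.
  rewrite card_imset // cardE /Gamma; congr size.
  by rewrite enumT /enum_mem; apply: eq_filter => e /=; rewrite inE.
rewrite /dcover_incident; case: (split v) => u.
  rewrite -(greg u) -(card_imset (mem [set w | g u w]) (f := fun w => (u, w))).
    apply: eq_card => -[a b]; rewrite !inE /=; apply/andP/imsetP.
      by case=> gab /eqP au; exists b; rewrite ?inE -au.
    by case=> w; rewrite inE => guw [-> ->].
  by move=> a b [].
rewrite -(greg u) -(card_imset (mem [set w | g u w]) (f := fun w => (w, u))).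
  apply: eq_card => -[a b]; rewrite !inE /=; apply/andP/imsetP.
    by case=> gab /eqP au; exists a; rewrite ?inE -au // gC.
  by case=> w; rewrite inE => guw [-> ->]; rewrite gC.
by move=> a b [].
Qed.

Lemma tanner_matrixE (R : realType) (N d k : nat)
    (ell : 'I_(d * N) -> 'I_N * 'I_N) (C0 : 'M[R]_(k, d)) (x : 'cV[R]_(d * N)) :
  tanner_matrix ell C0 *m x = tanner_map ell C0 x.
Proof.
apply/colP => r; rewrite !mxE; case/mxvec_indexP: r => v i.
rewrite mxvecE !mxE.
under eq_bigr => e _.
  rewrite /tanner_map !mxE mxvecE !mxE mulr_suml.
  under eq_bigr => j _ do rewrite mxE -mulrA.
  over.
rewrite exchange_big /=; apply: eq_bigr => j _; rewrite -mulr_sumr mxE; congr (_ * _).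
have [jlt|jge] := ltnP j (size (Gamma ell v)); last first.
  rewrite big1 => [|e _]; first by rewrite nth_default // size_map.
  by rewrite nth_default ?mul0r // size_map.
case: (Gamma ell v) jlt => // e0 s jlt.
rewrite (nth_map e0) // (bigD1 (nth e0 (e0 :: s) j)) //= big1 => [|e ne].
  by rewrite addr0 -[_ :: map _ _]/(map _ (e0 :: s)) (nth_map e0) // mxE !eqxx mul1r.
by rewrite -[_ :: map _ _]/(map _ (e0 :: s)) (nth_map e0) // mxE eq_sym (negPf ne) mul0r.
Qed.

(* Main.v *)
Require Import Defs.
From mathcomp Require Import all_boot all_order all_algebra.
From mathcomp Require Import reals exp spectral complex ring lra.

Import Order.TTheory GRing.Theory Num.Theory.
Local Open Scope ring_scope.

(** By the expander mixing lemma, every nonempty set of at most [delta N d] edges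
    of the double cover touches a vertex with at most [delta0 d] of these edges.
    Peeling off such vertices one at a time assigns each edge of S to one of its
    endpoints so that every vertex v receives a set S_v of at most [delta0 d]
    edges.  The null space property of [C0] applies to S_v inside the local view
    of v.  Summing over v, an edge of S lies in one S_v and in one complement
    Gamma(v) \ S_v, and an edge outside S lies in two complements, so
      |x_S| <= rho0 (2 |x_(~S)| + |x_S|) + tau0 |A x|. *)

(** * Spectral gap of normal matrices *)

Lemma intertwined_char_poly (F : fieldType) (n : nat) (P A B : 'M[F]_n) :
  P \in unitmx -> P *m A = B *m P -> char_poly A = char_poly B.
Proof.
move=> Pu PA; pose Pp := map_mx polyC P.
(* The intertwining lifts to the characteristic matrices. Taking determinants, the nonzero constant
   [\det Pp] cancels from both sides. *)
have E : Pp *m char_poly_mx A = char_poly_mx B *m Pp.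
  rewrite /char_poly_mx mulmxBr mulmxBl -!map_mxM PA; congr (_ - _).
  by rewrite mul_mx_scalar mul_scalar_mx.
have nz : \det Pp != 0.
  by rewrite det_map_mx polyC_eq0 -unitfE -unitmxE.
apply: (mulfI nz); rewrite /char_poly -det_mulmx E det_mulmx.
exact: mulrC.
Qed.

(** In a list sorted by decreasing norm, only the head can exceed the second entry in norm. Counting
    with multiplicity is what turns this into uniqueness of the index rather than of the value. *)
Lemma above_second_norm_uniq (F : numDomainType) (n : nat) (D : 'I_n -> F)
    (t : seq F) (i j : 'I_n) :
  perm_eq t [seq D i | i <- enum 'I_n] ->
  sorted (fun a b : F => `|b| <= `|a|) t ->
  ~~ (`|D i| <= `|t`_1|) -> ~~ (`|D j| <= `|t`_1|) -> i = j.
Proof.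
move=> tD tsort Di Dj; pose a (z : F) := ~~ (`|z| <= `|t`_1|).
have ct : (count a t <= 1)%N.
  (* A list with at most one entry has default second entry 0, and the count is then trivially at
     most 1. *)
  case: t tsort {tD Di Dj} @a => [|z [|z1 t]] //=; first by case: (~~ _).
  case/andP=> _; rewrite path_sortedE => [/andP[/allP le_t _]|x y z' yx z'y].
    rewrite lexx /= (@eq_in_count _ _ pred0) ?count_pred0 ?addn0 //.
      by case: (~~ _).
    by move=> x xt; rewrite /= le_t.
  exact: le_trans z'y yx.
have : (#|[pred i | a (D i)]| <= 1)%N.
  apply: leq_trans ct; rewrite (permP tD) count_map.
  by rewrite -sum1_card -sum1_count big_enum_cond.
by move/card_le1_eqP; apply.
Qed.

Section SpectralGap.
Local Open Scope sesquilinear_scope.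
Variables (C : numClosedFieldType) (n : nat).
Implicit Types (M Q : 'M[C]_n) (x u : 'rV[C]_n).

Lemma mulmx_trCE x u : (x *m u^t* ) 0 0 = \sum_i x 0 i * (u 0 i)^*.
Proof. by rewrite mxE; apply: eq_bigr => i _; rewrite !mxE. Qed.

Lemma mulmx_trC_unitary Q x u : Q \is unitarymx ->
  (x *m Q^t* ) *m (u *m Q^t* )^t* = x *m u^t*.
Proof.
move=> Qu; rewrite trmx_mul map_mxM /= trmxCK mulmxA -(mulmxA x).
by rewrite -(invmx_unitary Qu) mulVmx ?mulmx1 // unitarymx_unit.
Qed.

(** In an orthonormal eigenbasis, [M] scales each coordinate by its eigenvalue. The only eigenvalue
    that can exceed the claimed bound is the dominant one, and there the coordinate of [x] vanishes
    by orthogonality to [u]. *)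
Lemma normal_spectral_gap M u (a : C) (t : seq C) x :
  M \is normalmx -> u != 0 -> u *m M = a *: u ->
  char_poly M = \prod_(z <- t) ('X - z%:P) ->
  sorted (fun a b : C => `|b| <= `|a|) t ->
  (forall z, z \in t -> `|z| <= `|a|) ->
  \sum_i x 0 i * (u 0 i)^* = 0 ->
  \sum_i `|(x *m M) 0 i| ^+ 2 <= `|t`_1| ^+ 2 * \sum_i `|x 0 i| ^+ 2.
Proof.
move=> /orthomx_spectralP; set Q := spectralmx M; set D := spectral_diag M.
have Qu : Q \is unitarymx := spectral_unitarymx M.
have Qunit := unitarymx_unit Qu.
move=> ME u0 uM chM tsort t_le xu.
have tD : perm_eq t [seq D 0 i | i <- enum 'I_n].
  apply: prod_XsubC_eq; rewrite -chM big_map big_enum /=.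
  rewrite (@intertwined_char_poly _ _ Q M (diag_mx D)) //.
    rewrite char_poly_trig ?diag_mx_is_trig //.
    by apply: eq_bigr => i _; rewrite mxE eqxx.
  by rewrite {1}ME !mulmxA mulmxV // mul1mx.
(* Coordinates of [x] and [u] in the eigenbasis formed by the rows of [Q]. *)
pose y := x *m Q^t*; pose w := u *m Q^t*.
have MQ : M *m Q^t* = Q^t* *m diag_mx D.
  by rewrite -(invmx_unitary Qu) {1}ME mulmxK.
have sqE (z : 'rV[C]_n) : \sum_i `|z 0 i| ^+ 2 = \sum_i `|(z *m Q^t* ) 0 i| ^+ 2.
  transitivity ((z *m z^t* ) 0 0).
    by rewrite mulmx_trCE; apply: eq_bigr => i _; rewrite normCK.
  rewrite -(mulmx_trC_unitary _ z z Qu) mulmx_trCE.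
  by apply: eq_bigr => i _; rewrite normCK.
have wD i : w 0 i * D 0 i = a * w 0 i.
  have : w *m diag_mx D = a *: w.
    by rewrite /w -mulmxA -MQ mulmxA uM scalemxAl.
  by move/rowP/(_ i); rewrite mul_mx_diag !mxE.
have [j wj] : exists j, w 0 j != 0.
  apply/existsP; apply: contraNT u0; rewrite negb_exists => /forallP w0.
  have -> : u = w *m Q by rewrite /w mulmxKtV.
  have -> : w = 0 by apply/rowP => i; rewrite [RHS]mxE; apply/eqP/negPn/w0.
  by rewrite mul0mx.
have Dw i : w 0 i != 0 -> D 0 i = a.
  by move=> wi; apply: (mulfI wi); rewrite wD mulrC.
have yw : \sum_i y 0 i * (w 0 i)^* = 0.
  by rewrite -mulmx_trCE mulmx_trC_unitary // mulmx_trCE.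
rewrite (sqE (x *m M)) (sqE x) mulr_sumr; apply: ler_sum => i _.
rewrite -mulmxA MQ mulmxA -/y mul_mx_diag mxE normrM exprMn mulrC.
have [le|nle] := boolP (`|D 0 i| <= `|t`_1|).
  by rewrite ler_wpM2r ?exprn_ge0 // lerXn2r // nnegrE.
(* [D 0 i] is then the only eigenvalue above `|t`_1|, hence it is [a] and [u]
   spans its eigenline. *)
have Da : ~~ (`|a| <= `|t`_1|).
  apply: contraNN nle => /(le_trans _); apply; apply: t_le.
  by rewrite (perm_mem tD); apply/mapP; exists i; rewrite ?mem_enum.
have wi k : k != i -> w 0 k = 0.
  move=> ki; apply/eqP; apply: contraNT ki => wk; apply/eqP.
  by apply: (@above_second_norm_uniq _ _ (D 0) t) => //; rewrite Dw.
have ji : j = i by apply/eqP; apply: contraNT wj => /wi ->.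
(* As [w] is supported on [i] alone, the inner product of [y] and [w] reduces to its [i]-th term, so
   orthogonality kills [y 0 i]. *)
suff -> : y 0 i = 0 by rewrite normr0 expr0n !mulr0.
move: yw; rewrite (bigD1 i) //= big1 => [|k /wi ->]; last by rewrite conjC0 mulr0.
move/eqP; rewrite addr0 mulf_eq0 conjC_eq0 -{2}ji (negPf wj) orbF.
by move/eqP.
Qed.

End SpectralGap.

(** * Regular graphs and the expander mixing lemma *)

Lemma cauchy_schwarz_sum (R : realDomainType) (I : finType) (a b : I -> R) :
  (\sum_i a i * b i) ^+ 2 <= (\sum_i a i ^+ 2) * (\sum_i b i ^+ 2).
Proof.
have : 0 <= \sum_i \sum_j (a i * b j - a j * b i) ^+ 2.
  by apply: sumr_ge0 => i _; apply: sumr_ge0 => j _; apply: sqr_ge0.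
(* Lagrange's identity, with both orders of each pair counted, hence the factor 2. *)
have -> : \sum_i \sum_j (a i * b j - a j * b i) ^+ 2 =
    ((\sum_i a i ^+ 2) * (\sum_i b i ^+ 2) - (\sum_i a i * b i) ^+ 2) *+ 2.
  have E1 : (\sum_i a i ^+ 2) * (\sum_i b i ^+ 2) =
      \sum_i \sum_j a i ^+ 2 * b j ^+ 2.
    by rewrite mulr_suml; apply: eq_bigr => i _; rewrite mulr_sumr.
  have E2 : (\sum_i a i * b i) ^+ 2 = \sum_i \sum_j a i * b i * (a j * b j).
    by rewrite expr2 mulr_suml; apply: eq_bigr => i _; rewrite mulr_sumr.
  transitivity (\sum_i \sum_j a i ^+ 2 * b j ^+ 2 + \sum_i \sum_j a j ^+ 2 * b i ^+ 2
      - 2 * \sum_i \sum_j a i * b i * (a j * b j)).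
    rewrite -big_split /= mulr_sumr -sumrB; apply: eq_bigr => i _.
    rewrite -big_split /= mulr_sumr -sumrB; apply: eq_bigr => j _; ring.
  rewrite [X in _ + X - _]exchange_big /= -E1 -E2; ring.
by rewrite pmulrn_lge0 // subr_ge0.
Qed.

Section RegularGraph.
Variables (R : realType) (N d : nat) (g : rel 'I_N).
Hypothesis g_sym : symmetric g.
Hypothesis g_reg : forall u, #|[set v | g u v]| = d.

Lemma adjacency_row_sum u : \sum_v adjacency R g u v = d%:R.
Proof.
rewrite -(g_reg u) -sum1_card natr_sum [RHS]big_mkcond /=.
by apply: eq_bigr => v _; rewrite mxE inE; case: (g u v).
Qed.

(** Compare 1-norms in [v *m A = z *: v]: the row sums of the nonnegative matrix [A] are [d], so it
    expands the 1-norm by at most [d]. *)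
Lemma adjacency_eigenvalue_le z : eigenvalue (adjacency R g) z -> `|z| <= d%:R.
Proof.
case/eigenvalueP => v vz v0.
have [i vi] : exists i, v 0 i != 0.
  apply/existsP; apply: contraNT v0; rewrite negb_exists => /forallP w0.
  by apply/eqP/rowP => i; rewrite [RHS]mxE; apply/eqP/negPn/w0.
have pos : 0 < \sum_i `|v 0 i|.
  rewrite (bigD1 i) //= ltr_pwDl ?normr_gt0 //.
  by apply: sumr_ge0.
rewrite -(ler_pM2r pos) mulr_sumr.
have -> : \sum_i `|z| * `|v 0 i| = \sum_i `|(v *m adjacency R g) 0 i|.
  by apply: eq_bigr => k _; rewrite vz mxE normrM.
apply: (@le_trans _ _ (\sum_k \sum_j `|v 0 j| * adjacency R g j k)).
  apply: ler_sum => k _; rewrite mxE; apply: le_trans (ler_norm_sum _ _ _) _.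
  by apply: ler_sum => j _; rewrite normrM [X in _ * `|X|]mxE normr_nat mxE.
rewrite exchange_big mulr_sumr; apply: ler_sum => j _ /=.
by rewrite -mulr_sumr adjacency_row_sum mulrC.
Qed.

Local Notation toC := (real_complex R).

(** The gap lemma is applied over [R[i]] with [u] the all-ones vector, an eigenvector for [d], which
    dominates the spectrum. Orthogonality to [u] is the zero-sum condition. *)
Lemma adjacency_contracts_zero_sum lambda (x : 'rV[R]_N) :
  second_abs_eigenvalue_le (adjacency R g) lambda -> \sum_i x 0 i = 0 ->
  \sum_i (x *m adjacency R g) 0 i ^+ 2 <= lambda ^+ 2 * \sum_i x 0 i ^+ 2.
Proof.
(* Without vertices the all-ones vector is zero, hence not an eigenvector. *)
case=> s [[chs ssort] s1]; have [N0|N0] := posnP N.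
  by move=> _; rewrite !big1 ?mulr0 // => i; have := ltn_ord i; rewrite {2}N0.
move=> x0; set M := adjacency R g.
have normC (z : R) : `|toC z| = toC `|z|.
  by rewrite normc_def /= expr0n /= addr0 sqrtr_sqr.
have Mgap := @normal_spectral_gap R[i] N (map_mx toC M) (const_mx 1) (toC d%:R)
  (map toC s) (map_mx toC x).
have nth1 : (map toC s)`_1 = toC s`_1.
  have [lt|ge] := ltnP 1 (size s); first exact: nth_map.
  by rewrite !nth_default ?size_map // rmorph0.
have sqC (y : 'rV[R]_N) : \sum_i `|map_mx toC y 0 i| ^+ 2 = toC (\sum_i y 0 i ^+ 2).
  rewrite rmorph_sum /=; apply: eq_bigr => i _.
  by rewrite mxE normC -rmorphXn /= real_normK ?num_real.
move: Mgap; rewrite -map_mxM !sqC nth1 (normC s`_1) -rmorphXn -rmorphM lecR => Mgap.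
apply: le_trans (Mgap _ _ _ _ _ _ _) _ => {Mgap}.
- apply: hermitian_normalmx; apply: realsym_hermsym.
    apply/is_hermitianmxP; rewrite expr0 scale1r; apply/matrixP => i j.
    by rewrite !mxE g_sym.
  by apply/mxOverP => i j; rewrite !mxE; apply/complex_realP; exists (g i j)%:R.
- apply/eqP => /rowP/(_ (Ordinal N0)); rewrite !mxE => /eqP.
  by rewrite oner_eq0.
- apply/rowP => j; rewrite !mxE mulr1 -(adjacency_row_sum j) rmorph_sum.
  by apply: eq_bigr => i _; rewrite !mxE mul1r g_sym.
- rewrite -map_char_poly chs rmorph_prod big_map; apply: eq_bigr => z _.
  by rewrite /= rmorphB /= map_polyX map_polyC.
- rewrite sorted_map; apply: sub_sorted ssort => a b /=.
  by rewrite !normC lecR.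
- move=> _ /mapP[z zs ->]; rewrite !normC lecR normr_nat.
  apply: adjacency_eigenvalue_le; rewrite eigenvalue_root_char chs.
  by rewrite root_prod_XsubC.
- transitivity (toC (\sum_i x 0 i)); last by rewrite x0 rmorph0.
  by rewrite rmorph_sum; apply: eq_bigr => i _; rewrite !mxE conjC1 mulr1.
rewrite ler_wpM2r ?sumr_ge0 //; first by move=> i _; apply: sqr_ge0.
by rewrite lerXn2r ?nnegrE ?(le_trans (normr_ge0 _) s1).
Qed.

(** The indicator of [A] splits into its mean and a zero-sum part [a]. The mean yields the main
    term; the error pairs the image of [a] with the indicator of [B] and is bounded by contraction
    and Cauchy-Schwarz. *)
Lemma expander_mixing lambda (A B : {set 'I_N}) :
  second_abs_eigenvalue_le (adjacency R g) lambda ->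
  \sum_(u in A) \sum_(v in B) (g u v)%:R <=
    d%:R * #|A|%:R * #|B|%:R / N%:R + lambda * Num.sqrt (#|A|%:R * #|B|%:R).
Proof.
move=> lam; have lam0 : 0 <= lambda.
  by case: lam => s [_]; apply: le_trans.
have [N0|N0] := posnP N.
  rewrite big1 => [|u _]; last by move: (ltn_ord u); rewrite {2}N0.
  by rewrite addr_ge0 ?mulr_ge0 ?invr_ge0 ?ler0n ?sqrtr_ge0.
have NR0 : (N%:R : R) != 0 by rewrite pnatr_eq0 -lt0n.
pose c : R := #|A|%:R / N%:R.
pose a : 'rV[R]_N := \row_i ((i \in A)%:R - c).
have ind (T : {set 'I_N}) (F : 'I_N -> R) : \sum_(i in T) F i = \sum_i (i \in T)%:R * F i.
  rewrite big_mkcond; apply: eq_bigr => i _.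
  by case: (i \in T); rewrite ?mul1r ?mul0r.
have card (T : {set 'I_N}) : \sum_i (i \in T)%:R = #|T|%:R :> R.
  rewrite -sum1_card natr_sum ind; apply: eq_bigr => i _; by rewrite mulr1.
have a0 : \sum_i a 0 i = 0.
  under eq_bigr do rewrite mxE.
  by rewrite big_split /= card sumrN sumr_const card_ord -(mulr_natr c) /c divfK ?subrr.
have na : \sum_i a 0 i ^+ 2 <= #|A|%:R.
  have -> : \sum_i a 0 i ^+ 2 = #|A|%:R - c * #|A|%:R.
    (* Indicators are idempotent, so the square of [a 0 i] is the indicator minus [c] times the
       indicator minus [c * a 0 i], and the last term sums to zero. *)
    transitivity (\sum_i ((i \in A)%:R - c * (i \in A)%:R) - c * \sum_i a 0 i).
      rewrite mulr_sumr -sumrB; apply: eq_bigr => i _; rewrite !mxE.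
      by case: (i \in A); rewrite /=; ring.
    by rewrite a0 mulr0 subr0 sumrB -mulr_sumr card.
  by rewrite lerBlDr lerDl !mulr_ge0 ?invr_ge0 ?ler0n.
have colsum v : \sum_u (g u v)%:R = d%:R :> R.
  by rewrite -(adjacency_row_sum v); apply: eq_bigr => u _; rewrite mxE g_sym.
have aME v : (a *m adjacency R g) 0 v = \sum_(u in A) (g u v)%:R - c * d%:R.
  rewrite mxE ind -(colsum v) mulr_sumr -sumrB.
  by apply: eq_bigr => u _; rewrite !mxE mulrBl.
have E : \sum_(u in A) \sum_(v in B) (g u v)%:R =
    d%:R * #|A|%:R * #|B|%:R / N%:R + \sum_v (a *m adjacency R g) 0 v * (v \in B)%:R.
  rewrite exchange_big /= ind.
  under [X in _ = _ + X]eq_bigr => v _ do rewrite aME mulrBl mulrC.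
  by rewrite sumrB -[X in _ = _ + (_ - X)]mulr_sumr card /c; field.
rewrite E lerD2l; set q := \sum_v _.
have q2 : q ^+ 2 <= lambda ^+ 2 * (#|A|%:R * #|B|%:R).
  apply: le_trans (cauchy_schwarz_sum _ _ _ _) _.
  have -> : \sum_v ((v \in B)%:R : R) ^+ 2 = #|B|%:R.
    by rewrite -card; apply: eq_bigr => v _; case: (v \in B); rewrite ?expr1n ?expr0n.
  rewrite mulrA ler_wpM2r ?ler0n //.
  apply: le_trans (adjacency_contracts_zero_sum _ _ lam a0) _.
  by rewrite ler_wpM2l // sqr_ge0.
apply: le_trans (ler_norm q) _.
rewrite -sqrtr_sqr (_ : lambda * _ = Num.sqrt (lambda ^+ 2 * (#|A|%:R * #|B|%:R))).
  exact: ler_wsqrtr.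
by rewrite [RHS]sqrtrM ?sqr_ge0 // sqrtr_sqr ger0_norm.
Qed.

End RegularGraph.

(** * Orienting edges by peeling *)

(** Induction on the size of [S]: all edges of [S] at a light vertex [v] go to [v], and the
    remaining ones are oriented recursively. Requiring an edge of [S'] at [v] makes the set shrink;
    [f0] only supplies a map when [S] is empty. *)
Lemma peeling_orientation (T V : finType) (inc : V -> pred T) (small : pred nat)
    (f0 : T -> V) (S : {set T}) :
  (forall m n, (m <= n)%N -> small n -> small m) ->
  small 0 ->
  (forall S' : {set T}, S' \subset S -> S' != set0 ->
     exists v, [exists e in S', inc v e] && small #|[set e in S' | inc v e]|) ->
  exists f : T -> V, (forall e, e \in S -> inc (f e) e) /\
    (forall v, small #|[set e in S | f e == v]|).
Proof.
move=> smallS small0; have [m] := ubnP #|S|.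
elim: m S => // m IH S; rewrite ltnS => Sm peel.
have [->|S0] := eqVneq S set0.
  exists f0; split=> [e|v]; first by rewrite inE.
  apply: smallS small0; rewrite leqn0 cards_eq0; apply/eqP/setP => e.
  by rewrite !inE.
have [v /andP[/existsP[e0 /andP[e0S ve0]] vsmall]] := peel S (subxx _) S0.
pose S1 := [set e in S | ~~ inc v e].
have S1S : S1 \subset S by apply/subsetP => e; rewrite inE => /andP[].
have S1m : (#|S1| < m)%N.
  apply: leq_trans Sm; apply: proper_card; apply/properP; split=> //.
  by exists e0; rewrite // inE ve0 andbF.
have [|f [finc fsmall]] := IH S1 S1m.
  by move=> S' S'S1; apply: peel; apply: subset_trans S1S.
exists (fun e => if inc v e then v else f e); split=> [e eS|w].
  by case: ifPn => // ve; apply: finc; rewrite inE eS.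
(* The recursive map sends no remaining edge to [v], since those edges avoid [v]. So [v] receives
   only the edges peeled with it, and any other [w] gains none. *)
have [->|wv] := eqVneq w v.
  apply: smallS vsmall; apply: subset_leq_card; apply/subsetP => e.
  rewrite !inE => /andP[eS]; rewrite eS; case: ifPn => //= ve /eqP fe.
  by have := finc e; rewrite inE eS ve fe (negPf ve) => /(_ isT).
apply: smallS (fsmall w); apply: subset_leq_card; apply/subsetP => e.
rewrite !inE => /andP[eS]; rewrite eS; case: ifPn => //= _.
by rewrite eq_sym (negPf wv).
Qed.

(** * Local views in the double cover *)

Section DoubleCover.
Variables (R : realType) (N d : nat) (g : rel 'I_N).
Variable ell : 'I_(d * N) -> 'I_N * 'I_N.
Hypothesis g_sym : symmetric g.
Hypothesis g_reg : forall u, #|[set v | g u v]| = d.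
Hypothesis ellP : edge_labelling g ell.

Lemma dcover_incident_lshift u p : dcover_incident (lshift N u) p = (p.1 == u).
Proof. by rewrite /dcover_incident (unsplitK (inl u)). Qed.

Lemma dcover_incident_rshift u p : dcover_incident (rshift N u) p = (p.2 == u).
Proof. by rewrite /dcover_incident (unsplitK (inr u)). Qed.

(** Each edge has one endpoint in L and one in R, so the stars on either side partition the
    edges. *)
Lemma sum_dcover_incident (F : 'I_(d * N) -> R) :
  \sum_v \sum_(e | dcover_incident v (ell e)) F e = (\sum_e F e) *+ 2.
Proof.
rewrite big_split_ord mulr2n /=; congr (_ + _).
  rewrite (partition_big (fun e => (ell e).1) predT) //=.
  by apply: eq_bigr => u _; apply: eq_bigl => e; rewrite dcover_incident_lshift.
rewrite (partition_big (fun e => (ell e).2) predT) //=.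
by apply: eq_bigr => u _; apply: eq_bigl => e; rewrite dcover_incident_rshift.
Qed.

(** Positions in the tuple [Gamma ell v] correspond bijectively to the edges at [v]. The property of
    [C0] is used on the set [J] of positions that carry edges of [T]. *)
Lemma local_robust_nsp (k : nat) (C0 : 'M[R]_(k, d)) (s rho tau : R)
    (x : 'cV[R]_(d * N)) (v : 'I_(N + N)) (T : {set 'I_(d * N)}) :
  robust_nsp C0 s rho tau ->
  (forall e, e \in T -> dcover_incident v (ell e)) -> #|T|%:R <= s ->
  \sum_(e in T) `|x e 0| <=
    rho * (\sum_(e | dcover_incident v (ell e)) `|x e 0| - \sum_(e in T) `|x e 0|)
    + tau * norm1 (C0 *m local_view ell x v).
Proof.
move=> [_ _ _ nsp] Tinc Ts.
have szG : size (Gamma ell v) == d by rewrite (size_Gamma v g_sym g_reg ellP).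
pose G : d.-tuple 'I_(d * N) := Tuple szG.
have viewE j : local_view ell x v j 0 = x (tnth G j) 0.
  have tE := @tnth_map _ _ _ (fun e => x e 0) G j.
  by rewrite mxE -tE (tnth_nth 0).
pose J := [set j : 'I_d | tnth G j \in T].
have sumG (P : pred 'I_(d * N)) (F : 'I_(d * N) -> R) :
    \sum_(j | P (tnth G j)) F (tnth G j) =
    \sum_(e | dcover_incident v (ell e) && P e) F e.
  rewrite -(big_tuple _ _ G P F) /= /Gamma big_filter_cond /=.
  by rewrite big_enum_cond.
have sumT (F : 'I_(d * N) -> R) :
    \sum_(j in J) F (tnth G j) = \sum_(e in T) F e.
  under eq_bigl do rewrite inE.
  rewrite (sumG (mem T)); apply: eq_bigl => e /=.
  by case: (boolP (e \in T)) => [/Tinc ->|_]; rewrite ?andbF.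
have cardJ : #|J|%:R = #|T|%:R :> R.
  rewrite -!sum1_card !natr_sum.
  exact: (sumT (fun=> 1)).
have := nsp J (local_view ell x v); rewrite cardJ => /(_ Ts).
rewrite /norm1_on -(sumT (fun e => `|x e 0|)).
under eq_bigr do rewrite viewE.
move/le_trans; apply; rewrite lerD2r.
under eq_bigr do rewrite viewE.
have -> : \sum_(e | dcover_incident v (ell e)) `|x e 0| = \sum_j `|x (tnth G j) 0|.
  by rewrite (sumG predT (fun e => `|x e 0|)); apply: eq_bigl => e; rewrite andbT.
rewrite [X in _ <= _ * (X - _)](bigID (mem J)) /= addrAC subrr add0r.
by under eq_bigl do rewrite inE.
Qed.

Lemma norm1_tanner_matrix (k : nat) (C0 : 'M[R]_(k, d)) (x : 'cV[R]_(d * N)) :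
  norm1 (tanner_matrix ell C0 *m x) = \sum_v norm1 (C0 *m local_view ell x v).
Proof.
rewrite tanner_matrixE /norm1 /norm1_on.
under eq_bigl do rewrite inE.
(* Rows become pairs of a vertex and a row of [C0], so the norm splits into vertex blocks. *)
rewrite (reindex _ (curry_mxvec_bij (N + N) k)) /=.
transitivity (\sum_p `|tanner_map ell C0 x (mxvec_index p.1 p.2) 0|).
  by apply: eq_bigr => -[].
rewrite -(pair_bigA _ (fun v i => `|tanner_map ell C0 x (mxvec_index v i) 0|)) /=.
apply: eq_bigr => v _; under [RHS]eq_bigl do rewrite inE.
by apply: eq_bigr => i _; rewrite /tanner_map mxE mxvecE !mxE.
Qed.

Lemma oriented_robust_nsp (k : nat) (C0 : 'M[R]_(k, d)) (s rho tau : R)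
    (S : {set 'I_(d * N)}) (x : 'cV[R]_(d * N)) (f : 'I_(d * N) -> 'I_(N + N)) :
  robust_nsp C0 s rho tau ->
  (forall e, e \in S -> dcover_incident (f e) (ell e)) ->
  (forall v, #|[set e in S | f e == v]|%:R <= s) ->
  norm1_on S x <= rho * (2 * norm1_on (~: S) x + norm1_on S x)
    + tau * norm1 (tanner_matrix ell C0 *m x).
Proof.
move=> nsp finc fs.
have SE : norm1_on S x = \sum_v \sum_(e in [set e in S | f e == v]) `|x e 0|.
  rewrite /norm1_on (partition_big f predT) //=.
  by apply: eq_bigr => v _; apply: eq_bigl => e; rewrite inE.
have totE : \sum_e `|x e 0| = norm1_on S x + norm1_on (~: S) x.
  rewrite (bigID (mem S)) /=; congr (_ + _).
  by apply: eq_bigl => e; rewrite inE.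
(* The stars count the whole mass twice, and the fibres of [f] remove the mass on [S] once. *)
have -> : 2 * norm1_on (~: S) x + norm1_on S x =
    \sum_v (\sum_(e | dcover_incident v (ell e)) `|x e 0| -
            \sum_(e in [set e in S | f e == v]) `|x e 0|).
  by rewrite sumrB sum_dcover_incident -SE totE; ring.
rewrite norm1_tanner_matrix !mulr_sumr -big_split {1}SE; apply: ler_sum => v _.
apply: local_robust_nsp nsp _ (fs v) => e.
by rewrite inE => /andP[eS /eqP <-]; apply: finc.
Qed.

End DoubleCover.

(** * Existence of a light vertex *)

Lemma card_ge_fibers (R : realType) (T I : finType) (h : T -> I) (S : {set T}) (c : R) :
  (forall i, i \in h @: S -> c < #|[set e in S | h e == i]|%:R) ->
  c * #|h @: S|%:R <= #|S|%:R.
Proof.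
move=> big.
have -> : (#|S|%:R : R) = \sum_(i in h @: S) #|[set e in S | h e == i]|%:R.
  rewrite -natr_sum -sum1_card (partition_big_imset h) /=; congr (_%:R).
  apply: eq_bigr => i _; rewrite -sum1_card.
  by apply: eq_bigl => e; rewrite inE.
rewrite mulr_natr -sumr_const; apply: ler_sum => i /big; exact: ltW.
Qed.

Section LightVertex.
Variables (R : realType) (N d : nat) (g : rel 'I_N).
Variable ell : 'I_(d * N) -> 'I_N * 'I_N.
Hypothesis ellP : edge_labelling g ell.

(** Labels inject into adjacent pairs from [A] times [B]. The first component lies in L and the
    second in R, so no edge is counted twice. *)
Lemma card_edges_le (S : {set 'I_(d * N)}) (A B : {set 'I_N}) :
  (forall e, e \in S -> ((ell e).1 \in A) && ((ell e).2 \in B)) ->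
  #|S|%:R <= \sum_(u in A) \sum_(v in B) (g u v)%:R :> R.
Proof.
case: ellP => ell_inj ellE SAB.
have -> : \sum_(u in A) \sum_(v in B) (g u v)%:R =
    #|[set p in setX A B | g p.1 p.2]|%:R :> R.
  rewrite -sum1_card natr_sum pair_big /= [RHS]big_mkcond [LHS]big_mkcond /=.
  by apply: eq_bigr => p _; rewrite !inE; case: (_ \in A); case: (_ \in B); case: (g _ _).
rewrite ler_nat -(card_imset (mem S) ell_inj); apply: subset_leq_card.
apply/subsetP => _ /imsetP[e eS ->]; rewrite !inE SAB //=.
have : ell e \in dcover_edges g by rewrite -ellE imset_f.
by rewrite inE.
Qed.

(** Suppose every vertex touched by [S] is heavy. Then [S] touches few vertices on each side, and
    the mixing lemma allows too few edges between them. *)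
Lemma light_vertex (delta lambda : R) (S : {set 'I_(d * N)}) :
  expander d lambda g -> 0 < delta -> 16 / delta < d%:R ->
  lambda < 3 * Num.sqrt d%:R -> S != set0 -> #|S|%:R <= delta * N%:R * d%:R ->
  exists v, [exists e in S, dcover_incident v (ell e)] &&
    (#|[set e in S | dcover_incident v (ell e)]|%:R <= 2 * Num.sqrt delta * d%:R).
Proof.
move=> [g_sym _ g_reg lam] delta0 hd hlam S0 Sle.
apply/existsP; apply: contraT; rewrite negb_exists => /forallP heavy.
have {}heavy v e : e \in S -> dcover_incident v (ell e) ->
    2 * Num.sqrt delta * d%:R < #|[set e in S | dcover_incident v (ell e)]|%:R.
  move=> eS ve; have := heavy v; rewrite negb_and -ltNge; case/orP => //.
  by case/negP; apply/existsP; exists e; rewrite eS.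
pose A := [set (ell e).1 | e in S]; pose B := [set (ell e).2 | e in S].
have SA : 2 * Num.sqrt delta * d%:R * #|A|%:R <= #|S|%:R.
  apply: card_ge_fibers => _ /imsetP[e eS ->].
  have := heavy (lshift N (ell e).1) e eS.
  rewrite dcover_incident_lshift eqxx => /(_ isT).
  by under eq_finset do rewrite dcover_incident_lshift.
have SB : 2 * Num.sqrt delta * d%:R * #|B|%:R <= #|S|%:R.
  apply: card_ge_fibers => _ /imsetP[e eS ->].
  have := heavy (rshift N (ell e).2) e eS.
  rewrite dcover_incident_rshift eqxx => /(_ isT).
  by under eq_finset do rewrite dcover_incident_rshift.
have Sedges : #|S|%:R <= \sum_(u in A) \sum_(v in B) (g u v)%:R :> R.
  by apply: card_edges_le => e eS; apply/andP; split; apply: imset_f.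
have := le_trans Sedges (expander_mixing _ _ _ _ g_sym g_reg _ A B lam).
have [e eS] := set0Pn _ S0.
have A0 : (0 < #|A|%:R :> R).
  by rewrite ltr0n card_gt0; apply/set0Pn; exists (ell e).1; apply: imset_f.
have B0 : (0 < #|B|%:R :> R).
  by rewrite ltr0n card_gt0; apply/set0Pn; exists (ell e).2; apply: imset_f.
have N0 : (0 < N%:R :> R) by rewrite ltr0n; exact: leq_ltn_trans (ltn_ord (ell e).1).
have q0 : 0 < Num.sqrt delta by rewrite sqrtr_gt0.
have d0 : (0 < d%:R :> R) by apply: lt_trans hd; rewrite divr_gt0.
have r0 : 0 < Num.sqrt d%:R :> R by rewrite sqrtr_gt0.
have a0 : 0 < Num.sqrt (#|A|%:R * #|B|%:R) :> R by rewrite sqrtr_gt0 mulr_gt0.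
have := sqr_sqrtr (ltW (mulr_gt0 A0 B0)).
have := sqr_sqrtr (ltW d0); have := sqr_sqrtr (ltW delta0).
(* Only real arithmetic remains: [m] is the size of [S], [n] is [N], [D] is [d], while [q], [r] and
   [a] are the square roots of [delta], [d] and the product of the sizes of [A] and [B]. *)
move: q0 d0 r0 a0 SA SB Sle hd hlam.
set a := Num.sqrt (_ * _); set q := Num.sqrt delta; set r := Num.sqrt d%:R.
move: (#|A|%:R) (#|B|%:R) A0 B0 (#|S|%:R : R) (N%:R : R) N0 (d%:R : R) => nA nB A0 B0 m n n0 D.
move=> q0 D0 r0 a0 SA SB Sle hd hlam Eq Er Ea mix.
have qr : 4 < q * r.
  have : 16 < (q * r) ^+ 2 by rewrite exprMn Eq Er mulrC -ltr_pdivrMr.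
  have qr0 : 0 < q * r by rewrite mulr_gt0.
  nra.
have m0 : 0 <= m by apply: le_trans SA; rewrite !mulr_ge0 // ltW.
(* Geometric mean of [SA] and [SB]. *)
have Sa : 2 * q * D * a <= m.
  have c0 : 0 <= 2 * q * D by rewrite !mulr_ge0 // ltW.
  rewrite -(@ler_pXn2r _ 2) ?nnegrE ?mulr_ge0 // ?(ltW a0) ?(ltW q0) ?(ltW D0) //.
  rewrite exprMn Ea.
  have := ler_pM (mulr_ge0 c0 (ltW A0)) (mulr_ge0 c0 (ltW B0)) SA SB.
  rewrite !expr2 => h; apply: le_trans h; rewrite le_eqVlt; apply/orP; left.
  by apply/eqP; ring.
(* Chain [Sa] with the mixing bound and divide by [a]. *)
have mix' : n * (2 * q * D - lambda) <= D * a.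
  have : 2 * q * D * a <= D * nA * nB / n + lambda * a := le_trans Sa mix.
  have -> : D * nA * nB = D * a ^+ 2 by rewrite Ea mulrA.
  rewrite (_ : D * a ^+ 2 / n + lambda * a = (D * a / n + lambda) * a); last by ring.
  rewrite ler_pM2r // -lerBlDr ler_pdivlMr //.
  by rewrite mulrC.
have Sn : 2 * q * (n * (2 * q * D - lambda)) <= m.
  apply: le_trans Sa; rewrite -(mulrA _ D) ler_pM2l //; by rewrite mulr_gt0.
have qqD : 2 * q * (2 * q * D - lambda) <= delta * D.
  rewrite -(ler_pM2r n0) -[_ * D * n]mulrAC; apply: le_trans Sle.
  by apply: le_trans Sn; rewrite (mulrC n) mulrA.
(* With [delta] equal to the square of [q], [qqD] gives [3 * q * D <= 2 * lambda < 6 * r]. Since [D]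
   is the square of [r], this forces [q * r < 2], against [qr]. *)
have : q * lambda < q * (3 * r) by rewrite ltr_pM2l.
move: qqD; rewrite -Eq -Er; nra.
Qed.

End LightVertex.

Theorem theorem3 (R : realType) (delta delta0 rho0 tau0 lambda : R)
    (d k N : nat) (C0 : 'M[R]_(k, d)) (g : rel 'I_N)
    (ell : 'I_(d * N) -> 'I_N * 'I_N)
    (hdelta : 0 < delta)
    (hd : 16 / delta < d%:R)
    (hdelta0 : delta0 = 2 * Num.sqrt delta)
    (hk : k%:R <= 100 * delta0 * ln (1 / delta0) * d%:R)
    (hcol : forall j : 'I_d, #|[set i | C0 i j == 1]|%:R <= 100 * ln (1 / delta0))
    (hC0 : robust_nsp C0 (delta0 * d%:R) rho0 tau0)
    (hrho0 : rho0 < 1 / 3)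
    (hg : expander d lambda g)
    (hlambda : lambda < 3 * Num.sqrt d%:R)
    (hell : edge_labelling g ell) :
  robust_nsp (tanner_matrix ell C0) (delta * N%:R * d%:R)
    (2 * rho0 / (1 - rho0)) (tau0 / (1 - rho0)).
Proof.
have [rho_gt0 _ tau_gt0 _] := hC0; have [g_sym _ g_reg _] := hg.
have rho1 : 0 < 1 - rho0 by lra.
(* The new constant is below 1 exactly when [rho0 < 1 / 3]. *)
split; rewrite ?divr_gt0 ?mulr_gt0 //; first by rewrite ltr_pdivrMr //; lra.
move=> S x Sle.
have [||S' S'S S'0|f [finc fsmall]] := @peeling_orientation _ _
    (fun v e => dcover_incident v (ell e)) (fun m => m%:R <= delta0 * d%:R)
    (fun e => lshift N (ell e).1) S.
- by move=> m n mn; apply: le_trans; rewrite ler_nat.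
- by rewrite hdelta0 !mulr_ge0 ?sqrtr_ge0.
- have S'le : #|S'|%:R <= delta * N%:R * d%:R.
    by apply: le_trans Sle; rewrite ler_nat subset_leq_card.
  rewrite hdelta0.
  exact: (light_vertex _ _ _ _ _ hell _ _ _ hg hdelta hd hlambda S'0 S'le).
have := oriented_robust_nsp _ _ _ _ _ g_sym g_reg hell _ _ _ _ _ _ x f hC0 finc fsmall.
set s := norm1_on S x; set s' := norm1_on _ x; set y := norm1 _ => main.
(* In [main] the term [rho0 * s] moves to the left, and dividing by [1 - rho0] gives both
   constants. *)
have -> : 2 * rho0 / (1 - rho0) * s' + tau0 / (1 - rho0) * y =
    (2 * rho0 * s' + tau0 * y) / (1 - rho0) by ring.
by rewrite ler_pdivlMr //; lra.
Qed.
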